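(* Let $M$ be a nondegenerate, smooth, cylindrical, ruled surface in $\mathbb{L}^3$, parametrized by $X(s,t)=\gamma(s)+t\,w$, where $w=(0,0,1)$ and $\gamma(s)=(x(s),y(s),0)$ is a curve parametrized by arc length, lying in a plane orthogonal to $w$, i.e. $(x'(s))^2+(y'(s))^2=1$. If $M$ is a homothetic self-similar solution of the inverse mean curvature flow (with constant $C\in\mathbb{R}\setminus\{0\}$), then $$\gamma(s)=(r(s)\cos(t(s)),\ r(s)\sin(t(s)),\ 0),$$ where $$(r(s))^2=\left(1-\frac2C\right)s^2+k>0,\qquad t(s)=\pm\int\frac{\sqrt{\frac2C\left(1-\frac2C\right)s^2+k}}{\left(1-\frac2C\right)s^2+k}\,ds,$$ and $k\in\mathbb{R}$ is a constant. (Here the function $t(s)$ is not the ruling parameter $t$ of $X(s,t)$.)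
   Context: $\mathbb{L}^3$ is $\mathbb{R}^3$ with the metric $\langle x,y\rangle=x_1y_1+x_2y_2-x_3y_3$. The vector product $u\times v$ is defined by $\langle u\times v,x\rangle=\det(x,u,v)$ for all $x$. For $v\in\mathbb{L}^3$, $|v|=\sqrt{|\langle v,v\rangle|}$. For a surface with local parametrization $X(s,t)$ put $E=\langle X_s,X_s\rangle$, $F=\langle X_s,X_t\rangle$, $G=\langle X_t,X_t\rangle$. The surface is nondegenerate if $EG-F^2\neq0$ at all its points. It has unit normals $N=\pm\frac{X_s\times X_t}{|X_s\times X_t|}$, with $\langle N,N\rangle=\epsilon\in\{-1,1\}$. The mean curvature is $H=\frac{\epsilon}{2}\,\frac{\langle N,X_{ss}\rangle G-2\langle N,X_{st}\rangle F+\langle N,X_{tt}\rangle E}{EG-F^2}$. An immersion $X$ of a nondegenerate surface $M$ with nonzero mean curvature is a homothetic self-similar solution of the inverse mean curvature flow $\partial_tX=-\frac1HN$ if, for some positive function $\phi$ with $\phi(0)=1$, the family $\phi(t)X$ is a solution of the flow; this is expressed equivalently by the equation $C\langle N,X\rangle=-\frac1H$ for some constant $C\in\mathbb{R}\setminus\{0\}$, which is the constant $C$ in the statement. A ruled surface $X(s,t)=\gamma(s)+t\beta(s)$ is cylindrical if $\beta$ is a constant vector field.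
   Formalization: The formulas for r² and t(s) hold with s replaced by s−s0 for a constant s0 (the origin of arc length is free); for C=2 a further case is allowed: r²=ms+k with m≠0 and t=±∫√(ms+k−m²/4)/(ms+k) ds, e.g. the involute of a circle, which the printed claim misses. *)

(* Defs.v *)
From Stdlib Require Import Reals Lra.
From Coquelicot Require Import Coquelicot.
Open Scope R_scope.

Record L3 : Set := mkL3 { co1 : R; co2 : R; co3 : R }.

Definition ladd (u v : L3) : L3 :=
  mkL3 (co1 u + co1 v) (co2 u + co2 v) (co3 u + co3 v).
Definition lscal (a : R) (u : L3) : L3 :=
  mkL3 (a * co1 u) (a * co2 u) (a * co3 u).

Definition linner (u v : L3) : R :=
  co1 u * co1 v + co2 u * co2 v - co3 u * co3 v.
Definition lnorm (v : L3) : R := sqrt (Rabs (linner v v)).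

Definition ldet (u v w : L3) : R :=
  co1 u * (co2 v * co3 w - co3 v * co2 w)
  - co2 u * (co1 v * co3 w - co3 v * co1 w)
  + co3 u * (co1 v * co2 w - co2 v * co1 w).

(* The Lorentzian vector product is determined by
   <u x v, z> = det(z, u, v) for all z (see [lcross_unique]); the third
   coordinate is therefore opposite to the Euclidean one. *)
Definition lcross (u v : L3) : L3 :=
  mkL3 (co2 u * co3 v - co3 u * co2 v)
       (co3 u * co1 v - co1 u * co3 v)
       (co2 u * co1 v - co1 u * co2 v).

Lemma lcross_unique (u v p : L3) :
  (forall z, linner p z = ldet z u v) <-> p = lcross u v.
Proof.
split.
- intros H; destruct p as [p1 p2 p3].
  pose proof (H (mkL3 1 0 0)) as H1; pose proof (H (mkL3 0 1 0)) as H2.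
  pose proof (H (mkL3 0 0 1)) as H3; unfold linner, ldet, lcross in *.
  simpl in *; f_equal; lra.
- intros -> z; unfold linner, ldet, lcross; simpl; ring.
Qed.

Definition nonempty_open_interval (I : R -> Prop) : Prop :=
  exists a b : Rbar, Rbar_lt a b /\
    forall s : R, I s <-> Rbar_lt a s /\ Rbar_lt s b.

Definition lderive (f : R -> L3) (s : R) : L3 :=
  mkL3 (Derive (fun u => co1 (f u)) s)
       (Derive (fun u => co2 (f u)) s)
       (Derive (fun u => co3 (f u)) s).

Definition smooth_on (I : R -> Prop) (f : R -> L3) : Prop :=
  forall (n : nat) (s : R), I s ->
    ex_derive_n (fun u => co1 (f u)) n s /\
    ex_derive_n (fun u => co2 (f u)) n s /\
    ex_derive_n (fun u => co3 (f u)) n s.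

Definition ruled (gamma beta : R -> L3) (s t : R) : L3 :=
  ladd (gamma s) (lscal t (beta s)).

Definition d_s (X : R -> R -> L3) (s t : R) : L3 := lderive (fun u => X u t) s.
Definition d_t (X : R -> R -> L3) (s t : R) : L3 := lderive (fun v => X s v) t.

Definition ffE (X : R -> R -> L3) (s t : R) : R := linner (d_s X s t) (d_s X s t).
Definition ffF (X : R -> R -> L3) (s t : R) : R := linner (d_s X s t) (d_t X s t).
Definition ffG (X : R -> R -> L3) (s t : R) : R := linner (d_t X s t) (d_t X s t).

Definition nondegenerate (I J : R -> Prop) (X : R -> R -> L3) : Prop :=
  forall s t, I s -> J t -> ffE X s t * ffG X s t - ffF X s t ^ 2 <> 0.

Definition unit_normal (I J : R -> Prop) (X N : R -> R -> L3) : Prop :=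
  exists sg : R, (sg = 1 \/ sg = -1) /\
    forall s t, I s -> J t ->
      N s t = lscal (sg / lnorm (lcross (d_s X s t) (d_t X s t)))
                    (lcross (d_s X s t) (d_t X s t)).

Definition mean_curvature (X N : R -> R -> L3) (s t : R) : R :=
  linner (N s t) (N s t) / 2 *
  ((linner (N s t) (d_s (d_s X) s t) * ffG X s t
    - 2 * linner (N s t) (d_t (d_s X) s t) * ffF X s t
    + linner (N s t) (d_t (d_t X) s t) * ffE X s t)
   / (ffE X s t * ffG X s t - ffF X s t ^ 2)).

(* Homothetic self-similar solution of the inverse mean curvature flow, with
   constant [C].  The condition does not depend on the choice of the normal:
   [mean_curvature X N] changes sign with [N]. *)
Definition imcf_self_similar
    (I J : R -> Prop) (X N : R -> R -> L3) (C : R) : Prop :=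
  C <> 0 /\
  forall s t, I s -> J t ->
    mean_curvature X N s t <> 0 /\
    C * linner (N s t) (X s t) = - (1 / mean_curvature X N s t).

(* On [I], gamma = (r cos theta, r sin theta, 0) with r^2 = q > 0 and
   theta = +- \int sqrt(p) / q ds.  The indefinite integral is an arbitrary
   antiderivative on [I], and one sign is chosen for the whole of [I]. *)
Definition polar_form (I : R -> Prop) (gamma : R -> L3) (q p : R -> R) : Prop :=
  exists (r theta : R -> R) (sg : R), (sg = 1 \/ sg = -1) /\
    forall s, I s ->
      0 < r s /\ r s ^ 2 = q s /\ 0 < q s /\
      0 <= p s /\ is_derive theta s (sg * (sqrt (p s) / q s)) /\
      gamma s = mkL3 (r s * cos (theta s)) (r s * sin (theta s)) 0.

(* Main.v *)
Require Import Defs.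
From Stdlib Require Import Reals Lra.
From Coquelicot Require Import Coquelicot.
Open Scope R_scope.

(** A cylinder over a plane curve, with rulings orthogonal to the plane, is
    curved only along its base: for an arc-length base curve with tangent
    [(x', y')] and signed curvature [kappa = x' y'' - y' x''], the mean curvature
    is [- kappa / 2] up to the sign of the normal.  So the self-similarity
    equation constrains the base curve alone, and reads
    [C * g * kappa = 2], where [g = x y' - y x'] is the signed distance
    from the origin to the tangent line ([self_similar_cylinder_base]).

    Let [f = x x' + y y'].  Differentiating, with the Frenet equations
    [x'' = - kappa y'] and [y'' = kappa x'], gives
    [f' = 1 - kappa g = 1 - 2 / C].  Hence [f] is affine and
    [r ^ 2 = x ^ 2 + y ^ 2], whose derivative is [2 f], is quadratic with
    leading coefficient [a = 1 - 2 / C].  Since [f ^ 2 + g ^ 2 = r ^ 2] (the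
    tangent is a unit vector), [g ^ 2] is explicit as well; and [g] never
    vanishes, so it has a constant sign ([constant_sign]) and
    [g = +- sqrt (g ^ 2)] with one sign throughout.  The polar angle of a plane
    curve that avoids the origin has derivative [g / r ^ 2]
    ([polar_representation]), which is the announced integrand.

    The two alternatives come from normalising the quadratic
    [a s ^ 2 + 2 c s + d].  If [a <> 0], completing the square produces the
    centre [s0 = - c / a].  If [a = 0], that is [C = 2], the square cannot be
    completed: [r ^ 2] is affine, of slope [m = 2 c], and
    [g ^ 2 = r ^ 2 - m ^ 2 / 4]; slope zero (a circle centred at the origin)
    falls under the first form. *)

(** * Open intervals *)

Lemma interval_convex (I : R -> Prop) (a b c : R) :
  nonempty_open_interval I -> I a -> I b -> a <= c <= b -> I c.
Proof.
intros [l [u [_ H]]] Ha Hb Hc; apply H.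
apply H in Ha; apply H in Hb; destruct Ha as [Ha _], Hb as [_ Hb]; split.
- now apply Rbar_lt_le_trans with (Finite a).
- now apply Rbar_le_lt_trans with (Finite b).
Qed.

Lemma interval_open (I : R -> Prop) (s : R) :
  nonempty_open_interval I -> I s -> locally s I.
Proof.
intros [l [u [_ H]]].
apply (open_ext (T := R_UniformSpace) (fun z : R => Rbar_lt l z /\ Rbar_lt z u)).
- intros z; symmetry; apply H.
- apply open_and; [apply open_Rbar_gt | apply open_Rbar_lt].
Qed.

Lemma interval_inhabited (I : R -> Prop) :
  nonempty_open_interval I -> exists s, I s.
Proof.
intros [l [u [Hlu H]]].
destruct l as [l| |], u as [u| |]; simpl in Hlu; try easy.
- exists ((l + u) / 2); apply H; simpl; lra.
- exists (l + 1); apply H; simpl; lra.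
- exists (u - 1); apply H; simpl; lra.
- exists 0; apply H; simpl; tauto.
Qed.

Lemma interval_segment (I : R -> Prop) (a b c : R) :
  nonempty_open_interval I -> I a -> I b -> Rmin a b <= c <= Rmax a b -> I c.
Proof.
intros HI Ha Hb.
unfold Rmin, Rmax; destruct (Rle_dec a b); intros Hc;
  [apply interval_convex with a b | apply interval_convex with b a]; easy.
Qed.

(** The eta-expanded [Derive] is the form in which [auto_derive] leaves the
    derivative of a function variable. *)
Lemma is_derive_unique_eta (f : R -> R) (s l : R) :
  is_derive f s l -> Derive (fun u => f u) s = l.
Proof. exact (is_derive_unique f s l). Qed.

Lemma zero_derivative_constant (I : R -> Prop) (f : R -> R) (s0 s : R) :
  nonempty_open_interval I -> (forall u, I u -> is_derive f u 0) ->
  I s0 -> I s -> f s = f s0.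
Proof.
intros HI Hf H0 Hs.
destruct (MVT_gen f s0 s (fun _ => 0)) as [c [_ Hc]].
- intros u Hu; apply Hf, interval_segment with s0 s; try easy; lra.
- intros u Hu; apply continuity_pt_filterlim.
  apply (ex_derive_continuous f); exists 0.
  apply Hf, interval_segment with s0 s; easy.
- lra.
Qed.

Lemma constant_sign (I : R -> Prop) (g : R -> R) :
  nonempty_open_interval I -> (forall s, I s -> continuous g s) ->
  (forall s, I s -> g s <> 0) ->
  exists sg, (sg = 1 \/ sg = -1) /\ forall s, I s -> 0 < sg * g s.
Proof.
intros HI Hg Hnz.
assert (IVT : forall h a b, (forall s, I s -> continuous h s) -> I a -> I b ->
    a < b -> h a < 0 -> 0 < h b -> exists z, I z /\ h z = 0).
{ intros h a b Hh Ha Hb Hab Hna Hpb.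
  assert (Hin : forall u, a <= u <= b -> I u)
    by (intros u Hu; now apply interval_convex with a b).
  destruct (Ranalysis5.IVT_interv h a b) as [z [Hz Hz0]]; try easy.
  - intros u Hu; apply continuity_pt_filterlim, Hh, Hin, Hu.
  - exists z; auto. }
assert (no_change : forall a b, I a -> I b -> g a < 0 -> 0 < g b -> False).
{ intros a b Ha Hb Hna Hpb.
  destruct (Rtotal_order a b) as [Hab | [-> | Hab]]; [ | lra | ].
  - destruct (IVT g a b) as [z [Hz Hz0]]; auto.
    now apply (Hnz z).
  - destruct (IVT (fun u => - g u) b a) as [z [Hz Hz0]]; auto; try lra.
    + intros u Hu; now apply (continuous_opp g), Hg.
    + apply (Hnz z); [easy | lra]. }
destruct (interval_inhabited I HI) as [s0 Hs0].
destruct (Rdichotomy _ _ (Hnz s0 Hs0)) as [Hneg | Hpos].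
- exists (-1); split; [now right | intros s Hs].
  destruct (Rdichotomy _ _ (Hnz s Hs)); [lra | ].
  exfalso; now apply (no_change s0 s).
- exists 1; split; [now left | intros s Hs].
  destruct (Rdichotomy _ _ (Hnz s Hs)); [ | lra].
  exfalso; now apply (no_change s s0).
Qed.

Lemma antiderivative_through (I : R -> Prop) (h : R -> R) (s0 v0 : R) :
  nonempty_open_interval I -> (forall s, I s -> continuous h s) -> I s0 ->
  exists F, F s0 = v0 /\ forall s, I s -> is_derive F s (h s).
Proof.
intros HI Hh H0; exists (fun s => v0 + RInt h s0 s); split.
- rewrite RInt_point; unfold zero; simpl; ring.
- intros s Hs.
  replace (h s) with (0 + h s) by ring.
  apply (is_derive_plus (fun _ => v0) (RInt h s0)).
  + apply (is_derive_const v0).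
  + apply is_derive_RInt with s0; [ | now apply Hh].
    apply filter_imp with I; [ | now apply interval_open].
    intros b Hb; apply (RInt_correct h), (ex_RInt_continuous h).
    intros z Hz; apply Hh, interval_segment with s0 b; easy.
Qed.

(** * Polar coordinates along a plane curve *)

Lemma polar_angle (x y r : R) :
  0 < r -> r ^ 2 = x ^ 2 + y ^ 2 ->
  exists theta, x = r * cos theta /\ y = r * sin theta.
Proof.
intros Hr Hrr.
assert (Hu : (x / r) ^ 2 + (y / r) ^ 2 = 1).
{ replace 1 with (r ^ 2 / r ^ 2) by (field; lra); rewrite Hrr at 1; field; lra. }
assert (Hx : -1 <= x / r <= 1) by nra.
assert (Hs : sin (acos (x / r)) = Rabs (y / r)).
{ rewrite sin_acos by easy.
  rewrite <- sqrt_Rsqr_abs; f_equal; unfold Rsqr; nra. }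
assert (Hxr : x = r * (x / r)) by (field; lra).
assert (Hyr : y = r * (y / r)) by (field; lra).
destruct (Rle_dec 0 (y / r)) as [Hy | Hy].
- exists (acos (x / r)).
  rewrite cos_acos, Hs, Rabs_right by lra; easy.
- exists (- acos (x / r)).
  rewrite cos_neg, sin_neg, cos_acos, Hs, Rabs_left, Ropp_involutive by lra; easy.
Qed.

(** Both the rotated coordinate [A] in the numerator and the radius [r] satisfy
    [A' = (r' / r) A] when [theta] turns at the angular speed of [(x, y)]. *)
Lemma rotated_coordinate_over_radius (x y r theta : R -> R) (s x1 y1 : R) :
  0 < r s -> r s ^ 2 = x s ^ 2 + y s ^ 2 ->
  is_derive x s x1 -> is_derive y s y1 ->
  is_derive r s ((x s * x1 + y s * y1) / r s) ->
  is_derive theta s ((x s * y1 - y s * x1) / r s ^ 2) ->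
  is_derive (fun u => (x u * cos (theta u) + y u * sin (theta u)) / r u) s 0.
Proof.
intros Hr Hrr Dx Dy Dr Dth; auto_derive.
- repeat split; try (eexists; eassumption); lra.
- rewrite (is_derive_unique_eta _ _ _ Dx), (is_derive_unique_eta _ _ _ Dy),
    (is_derive_unique_eta _ _ _ Dth), (is_derive_unique_eta _ _ _ Dr).
  set (c := cos (theta s)); set (d := sin (theta s)).
  transitivity (((x1 * c + y1 * d) * r s ^ 2
      + (y s * c - x s * d) * (x s * y1 - y s * x1)
      - (x s * c + y s * d) * (x s * x1 + y s * y1)) / r s ^ 3).
  + field; lra.
  + rewrite Hrr at 1; field; lra.
Qed.

(** With [theta] an antiderivative of the angular speed, the coordinates of
    [(x, y)] in the frame rotated by [theta], divided by the radius, are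
    constant; the initial angle makes them [1] and [0]. *)
Lemma polar_representation (I : R -> Prop) (x y x1 y1 : R -> R) :
  nonempty_open_interval I ->
  (forall s, I s -> is_derive x s (x1 s)) ->
  (forall s, I s -> is_derive y s (y1 s)) ->
  (forall s, I s -> continuous x1 s) ->
  (forall s, I s -> continuous y1 s) ->
  (forall s, I s -> 0 < x s ^ 2 + y s ^ 2) ->
  exists theta, forall s, I s ->
    is_derive theta s ((x s * y1 s - y s * x1 s) / (x s ^ 2 + y s ^ 2)) /\
    x s = sqrt (x s ^ 2 + y s ^ 2) * cos (theta s) /\
    y s = sqrt (x s ^ 2 + y s ^ 2) * sin (theta s).
Proof.
intros HI Hx Hy Hx1 Hy1 Hpos.
assert (Cx : forall s, I s -> continuous x s)
  by (intros s Hs; apply (ex_derive_continuous x); eexists; now apply Hx).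
assert (Cy : forall s, I s -> continuous y s)
  by (intros s Hs; apply (ex_derive_continuous y); eexists; now apply Hy).
destruct (interval_inhabited I HI) as [s0 Hs0].
set (r := fun s => sqrt (x s ^ 2 + y s ^ 2)).
assert (Hr : forall s, I s -> 0 < r s)
  by (intros s Hs; now apply sqrt_lt_R0, Hpos).
assert (Hrr : forall s, I s -> r s ^ 2 = x s ^ 2 + y s ^ 2)
  by (intros s Hs; apply pow2_sqrt, Rlt_le, Hpos, Hs).
destruct (polar_angle (x s0) (y s0) (r s0)) as [th0 [Ex0 Ey0]]; auto.
set (h := fun s => (x s * y1 s - y s * x1 s) / (x s ^ 2 + y s ^ 2)).
destruct (antiderivative_through I h s0 th0) as [theta [Eth Hth]]; auto.
{ intros s Hs; unfold h, Rdiv; apply (continuous_mult (K := R_AbsRing)).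
  - apply (continuous_minus (V := R_NormedModule));
      apply (continuous_mult (K := R_AbsRing)); auto.
  - apply continuous_Rinv_comp; [ | apply Rgt_not_eq, Hpos, Hs].
    apply (ex_derive_continuous (fun u => x u ^ 2 + y u ^ 2)).
    auto_derive; repeat split; eexists; [now apply Hx | now apply Hy]. }
exists theta; intros s Hs; fold (h s) (r s); split; [now apply Hth | ].
assert (Dr : forall u, I u ->
    is_derive r u ((x u * x1 u + y u * y1 u) / r u)).
{ intros u Hu; pose proof (Hr u Hu); pose proof (Hpos u Hu).
  pose proof (Hx u Hu) as Dx; pose proof (Hy u Hu) as Dy.
  unfold r in *; auto_derive.
  - repeat split; try (eexists; eassumption); simpl in *; lra.
  - rewrite (is_derive_unique_eta _ _ _ Dx), (is_derive_unique_eta _ _ _ Dy).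
    replace (x u * (x u * 1) + y u * (y u * 1)) with (x u ^ 2 + y u ^ 2) by ring.
    field; lra. }
assert (Dth : forall u, I u ->
    is_derive theta u ((x u * y1 u - y u * x1 u) / r u ^ 2))
  by (intros u Hu; rewrite Hrr by easy; now apply Hth).
assert (EA : (x s * cos (theta s) + y s * sin (theta s)) / r s = 1).
{ transitivity ((x s0 * cos (theta s0) + y s0 * sin (theta s0)) / r s0).
  - apply (zero_derivative_constant I
      (fun u => (x u * cos (theta u) + y u * sin (theta u)) / r u)); auto.
    intros u Hu; apply rotated_coordinate_over_radius with (x1 u) (y1 u); auto.
  - pose proof (sin2_cos2 th0) as E; unfold Rsqr in E.
    pose proof (Hr s0 Hs0).
    rewrite Eth, Ex0, Ey0, <- E; field; lra. }
(* The second rotated coordinate is the first one of [(y, - x)]. *)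
assert (EB : (y s * cos (theta s) + - x s * sin (theta s)) / r s = 0).
{ transitivity ((y s0 * cos (theta s0) + - x s0 * sin (theta s0)) / r s0).
  - apply (zero_derivative_constant I
      (fun u => (y u * cos (theta u) + - x u * sin (theta u)) / r u)); auto.
    intros u Hu.
    apply (rotated_coordinate_over_radius y (fun v => - x v) r theta u
             (y1 u) (- x1 u)); auto.
    + rewrite Hrr by easy; ring.
    + apply (is_derive_opp x); auto.
    + replace (y u * y1 u + - x u * - x1 u)
        with (x u * x1 u + y u * y1 u) by ring; auto.
    + replace (y u * - x1 u - - x u * y1 u)
        with (x u * y1 u - y u * x1 u) by ring; auto.
  - rewrite Eth, Ex0, Ey0; pose proof (Hr s0 Hs0); field; lra. }
pose proof (Hr s Hs) as Hrs.
apply (Rmult_eq_compat_r (r s)) in EA; apply (Rmult_eq_compat_r (r s)) in EB.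
unfold Rdiv in EA, EB; rewrite Rmult_assoc, Rinv_l, Rmult_1_r in EA, EB by lra.
pose proof (sin2_cos2 (theta s)) as E; unfold Rsqr in E.
set (c := cos (theta s)) in *; set (e := sin (theta s)) in *.
split.
- transitivity ((x s * c + y s * e) * c - (y s * c + - x s * e) * e).
  + transitivity (x s * (e * e + c * c)); [rewrite E | ]; ring.
  + rewrite EA, EB; ring.
- transitivity ((x s * c + y s * e) * e + (y s * c + - x s * e) * c).
  + transitivity (y s * (e * e + c * c)); [rewrite E | ]; ring.
  + rewrite EA, EB; ring.
Qed.

(** * The base curve of a self-similar cylinder *)

Lemma self_similar_cylinder_base (I J : R -> Prop) (x y : R -> R)
    (N : R -> R -> L3) (C : R) :
  let gamma := fun s : R => mkL3 (x s) (y s) 0 in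
  let X := ruled gamma (fun _ : R => mkL3 0 0 1) in
  nonempty_open_interval J ->
  (forall s : R, I s -> Derive x s ^ 2 + Derive y s ^ 2 = 1) ->
  unit_normal I J X N ->
  imcf_self_similar I J X N C ->
  forall s, I s ->
    C * (x s * Derive y s - y s * Derive x s)
      * (Derive x s * Derive (Derive y) s - Derive y s * Derive (Derive x) s) = 2.
Proof.
intros gamma X HJ Hunit [sg [Hsg HN]] [HC HX] s Hs.
destruct (interval_inhabited J HJ) as [t Ht].
assert (Es : forall u v, d_s X u v = mkL3 (Derive x u) (Derive y u) 0).
{ intros u v; unfold d_s, lderive, X, ruled, gamma; simpl; f_equal.
  - apply Derive_ext; intros; ring.
  - apply Derive_ext; intros; ring.
  - apply Derive_const. }
assert (Et : forall u v, d_t X u v = mkL3 0 0 1).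
{ intros u v; unfold d_t, lderive, X, ruled, gamma; simpl; f_equal;
    apply is_derive_unique; auto_derive; trivial; ring. }
assert (Ess : d_s (d_s X) s t = mkL3 (Derive (Derive x) s) (Derive (Derive y) s) 0).
{ unfold d_s at 1, lderive; f_equal.
  - apply Derive_ext; intros; now rewrite Es.
  - apply Derive_ext; intros; now rewrite Es.
  - transitivity (Derive (fun _ => 0) s); [ | apply Derive_const].
    apply Derive_ext; intros; now rewrite Es. }
assert (Ett : d_t (d_t X) s t = mkL3 0 0 0).
{ unfold d_t at 1, lderive; f_equal.
  - transitivity (Derive (fun _ => 0) t); [ | apply Derive_const].
    apply Derive_ext; intros; now rewrite Et.
  - transitivity (Derive (fun _ => 0) t); [ | apply Derive_const].
    apply Derive_ext; intros; now rewrite Et.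
  - transitivity (Derive (fun _ => 1) t); [ | apply Derive_const].
    apply Derive_ext; intros; now rewrite Et. }
pose proof (Hunit s Hs) as Hu.
set (x1 := Derive x s) in *; set (y1 := Derive y s) in *.
set (x2 := Derive (Derive x) s) in *; set (y2 := Derive (Derive y) s) in *.
assert (EN : N s t = mkL3 (sg * y1) (- sg * x1) 0).
{ rewrite (HN s t Hs Ht), Es, Et; fold x1 y1.
  unfold lnorm, lcross, linner, lscal; simpl.
  match goal with |- context [sqrt (Rabs ?e)] =>
    replace e with (x1 ^ 2 + y1 ^ 2) by ring end.
  rewrite Hu, Rabs_R1, sqrt_1; f_equal; field. }
assert (Hsg2 : sg * sg = 1) by (destruct Hsg as [-> | ->]; ring).
assert (EH : mean_curvature X N s t = - sg * (x1 * y2 - y1 * x2) / 2).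
{ assert (EE : ffE X s t = 1)
    by (unfold ffE; rewrite Es, <- Hu; unfold linner; simpl; fold x1 y1; ring).
  assert (EF : ffF X s t = 0)
    by (unfold ffF; rewrite Es, Et; unfold linner; simpl; ring).
  assert (EG : ffG X s t = -1)
    by (unfold ffG; rewrite Et; unfold linner; simpl; ring).
  assert (ENN : linner (N s t) (N s t) = 1)
    by (rewrite EN; unfold linner; simpl;
        transitivity (sg * sg * (x1 ^ 2 + y1 ^ 2)); [ring | rewrite Hu, Hsg2; ring]).
  unfold mean_curvature; rewrite ENN, EE, EF, EG, Ess, Ett, EN.
  unfold linner; simpl; field. }
destruct (HX s t Hs Ht) as [HH HE].
rewrite EH in HH, HE; rewrite EN in HE.
unfold X, ruled, linner in HE; simpl in HE.
set (kappa := x1 * y2 - y1 * x2) in *.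
assert (Hk : kappa <> 0) by (intros E; apply HH; rewrite E; field).
assert (Hsg0 : sg <> 0) by (intros E; rewrite E in Hsg2; lra).
apply (Rmult_eq_compat_r (sg * kappa)) in HE.
replace (- (1 / (- sg * kappa / 2)) * (sg * kappa)) with 2 in HE
  by (field; split; assumption).
rewrite <- HE.
transitivity ((sg * sg) * (C * (x s * y1 - y s * x1) * kappa));
  [rewrite Hsg2; ring | ring].
Qed.

(** Differentiating [x' ^ 2 + y' ^ 2 = 1] shows that the acceleration is normal:
    [f' = 1 - kappa g] for the tangential component [f] of the position, so
    that a constant [kappa g] makes [f] affine and [r ^ 2] quadratic. *)
Lemma radius_quadratic (I : R -> Prop) (x y x1 y1 x2 y2 : R -> R) (b : R) :
  nonempty_open_interval I ->
  (forall s, I s -> is_derive x s (x1 s)) ->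
  (forall s, I s -> is_derive y s (y1 s)) ->
  (forall s, I s -> is_derive x1 s (x2 s)) ->
  (forall s, I s -> is_derive y1 s (y2 s)) ->
  (forall s, I s -> x1 s ^ 2 + y1 s ^ 2 = 1) ->
  (forall s, I s ->
    (x s * y1 s - y s * x1 s) * (x1 s * y2 s - y1 s * x2 s) = b) ->
  exists c d, forall s, I s ->
    x s * x1 s + y s * y1 s = (1 - b) * s + c /\
    x s ^ 2 + y s ^ 2 = (1 - b) * s ^ 2 + 2 * c * s + d.
Proof.
intros HI Hx Hy Hx1 Hy1 Hunit Hb.
destruct (interval_inhabited I HI) as [s0 Hs0].
assert (Hacc : forall s, I s -> x1 s * x2 s + y1 s * y2 s = 0).
{ intros s Hs.
  assert (D : is_derive (fun u => x1 u ^ 2 + y1 u ^ 2) s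
                (2 * (x1 s * x2 s + y1 s * y2 s))).
  { pose proof (Hx1 s Hs) as Dx; pose proof (Hy1 s Hs) as Dy; auto_derive.
    - repeat split; eexists; eassumption.
    - rewrite (is_derive_unique_eta _ _ _ Dx), (is_derive_unique_eta _ _ _ Dy); ring. }
  assert (D0 : is_derive (fun u => x1 u ^ 2 + y1 u ^ 2) s 0).
  { apply is_derive_ext_loc with (fun _ => 1); [ | apply (is_derive_const 1)].
    apply filter_imp with I; [ | now apply interval_open].
    intros u Hu; symmetry; auto. }
  apply is_derive_unique in D; apply is_derive_unique in D0; lra. }
set (f := fun s => x s * x1 s + y s * y1 s - (1 - b) * s).
assert (Hf : forall s, I s -> f s = f s0).
{ intros s Hs; apply (zero_derivative_constant I); auto.
  intros u Hu; unfold f.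
  pose proof (Hx u Hu) as Dx; pose proof (Hy u Hu) as Dy.
  pose proof (Hx1 u Hu) as Dx1; pose proof (Hy1 u Hu) as Dy1.
  auto_derive.
  - repeat split; eexists; eassumption.
  - rewrite (is_derive_unique_eta _ _ _ Dx), (is_derive_unique_eta _ _ _ Dy),
      (is_derive_unique_eta _ _ _ Dx1), (is_derive_unique_eta _ _ _ Dy1).
    pose proof (Hacc u Hu) as Ha; pose proof (Hunit u Hu) as Hu1.
    (* Expand [x x2 + y y2] in the orthonormal frame of tangent and normal. *)
    assert (E : x u * x2 u + y u * y2 u = - b).
    { rewrite <- (Hb u Hu).
      transitivity ((x1 u ^ 2 + y1 u ^ 2) * (x u * x2 u + y u * y2 u));
        [rewrite Hu1; ring | ].
      transitivity ((x u * x1 u + y u * y1 u) * (x1 u * x2 u + y1 u * y2 u)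
        - (x u * y1 u - y u * x1 u) * (x1 u * y2 u - y1 u * x2 u));
        [ring | rewrite Ha; ring]. }
    lra. }
set (q := fun s => x s ^ 2 + y s ^ 2 - ((1 - b) * s ^ 2 + 2 * f s0 * s)).
assert (Hq : forall s, I s -> q s = q s0).
{ intros s Hs; apply (zero_derivative_constant I); auto.
  intros u Hu; unfold q.
  pose proof (Hx u Hu) as Dx; pose proof (Hy u Hu) as Dy.
  auto_derive.
  - repeat split; eexists; eassumption.
  - rewrite (is_derive_unique_eta _ _ _ Dx), (is_derive_unique_eta _ _ _ Dy).
    rewrite <- (Hf u Hu); unfold f; ring. }
exists (f s0), (q s0); intros s Hs.
rewrite <- (Hq s Hs), <- (Hf s Hs) at 1; split; [unfold f; ring | ].
unfold q; ring.
Qed.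

(** * Polar form *)

Lemma smooth_plane_curve_derivatives (I : R -> Prop) (x y : R -> R) :
  smooth_on I (fun s => mkL3 (x s) (y s) 0) ->
  forall s, I s ->
    (is_derive x s (Derive x s) /\ is_derive y s (Derive y s)) /\
    (is_derive (Derive x) s (Derive (Derive x) s) /\
     is_derive (Derive y) s (Derive (Derive y) s)).
Proof.
intros H s Hs.
destruct (H 1%nat s Hs) as [Hx [Hy _]]; destruct (H 2%nat s Hs) as [Hx2 [Hy2 _]].
simpl in *; repeat split; apply Derive_correct; auto.
Qed.

(** [g = x y' - y x'] is the numerator of the angular speed; as it never
    vanishes, it is [+- sqrt (g ^ 2)] with one sign on the whole interval. *)
Lemma plane_curve_polar_form (I : R -> Prop) (x y q p : R -> R) :
  nonempty_open_interval I ->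
  smooth_on I (fun s => mkL3 (x s) (y s) 0) ->
  (forall s, I s -> x s * Derive y s - y s * Derive x s <> 0) ->
  (forall s, I s -> x s ^ 2 + y s ^ 2 = q s) ->
  (forall s, I s -> (x s * Derive y s - y s * Derive x s) ^ 2 = p s) ->
  polar_form I (fun s => mkL3 (x s) (y s) 0) q p.
Proof.
intros HI Hsm Hg Hq Hp.
pose proof (smooth_plane_curve_derivatives I x y Hsm) as HD.
assert (Hc : forall f : R -> R, (forall s, I s -> is_derive f s (Derive f s)) ->
    forall s, I s -> continuous f s)
  by (intros f Hf s Hs; apply (ex_derive_continuous f); eexists; now apply Hf).
assert (Hpos : forall s, I s -> 0 < x s ^ 2 + y s ^ 2).
{ intros s Hs; specialize (Hg s Hs).
  destruct (Req_dec (x s) 0) as [Ex | Ex]; [ | nra].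
  destruct (Req_dec (y s) 0) as [Ey | Ey]; [ | nra].
  exfalso; apply Hg; rewrite Ex, Ey; ring. }
destruct (constant_sign I (fun s => x s * Derive y s - y s * Derive x s))
  as [sg [Hsg Hsgn]]; auto.
{ intros s Hs; apply (continuous_minus (V := R_NormedModule));
    apply (continuous_mult (K := R_AbsRing)); apply Hc; auto; apply HD. }
destruct (polar_representation I x y (Derive x) (Derive y)) as [theta Hth]; auto.
all: try (intros s Hs; now apply HD).
1, 2: apply Hc; apply HD.
exists (fun s => sqrt (x s ^ 2 + y s ^ 2)), theta, sg; split; [easy | ].
intros s Hs; destruct (Hth s Hs) as [Dth [Ex Ey]].
assert (Hsg2 : sg * sg = 1) by (destruct Hsg as [-> | ->]; ring).
assert (Eg : sg * sqrt (p s) = x s * Derive y s - y s * Derive x s).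
{ specialize (Hsgn s Hs); simpl in Hsgn.
  set (g := x s * Derive y s - y s * Derive x s) in *.
  replace (sqrt (p s)) with (sg * g).
  - rewrite <- Rmult_assoc, Hsg2; ring.
  - rewrite <- (sqrt_pow2 (sg * g)) by lra; f_equal.
    rewrite <- (Hp s Hs); fold g.
    transitivity (sg * sg * g ^ 2); [ring | rewrite Hsg2; ring]. }
refine (conj _ (conj _ (conj _ (conj _ (conj _ _))))).
- now apply sqrt_lt_R0, Hpos.
- rewrite <- (Hq s Hs); apply pow2_sqrt, Rlt_le, Hpos, Hs.
- rewrite <- (Hq s Hs); auto.
- rewrite <- (Hp s Hs); apply pow2_ge_0.
- rewrite <- (Hq s Hs).
  replace (sg * (sqrt (p s) / (x s ^ 2 + y s ^ 2)))
    with (sg * sqrt (p s) / (x s ^ 2 + y s ^ 2)) by (unfold Rdiv; ring).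
  rewrite Eg; exact Dth.
- f_equal; assumption.
Qed.

Theorem theorem4p2 (I J : R -> Prop) (x y : R -> R) (N : R -> R -> L3) (C : R)
  (hI : nonempty_open_interval I) (hJ : nonempty_open_interval J) :
  let gamma := fun s : R => mkL3 (x s) (y s) 0 in
  let X := ruled gamma (fun _ : R => mkL3 0 0 1) in
  smooth_on I gamma ->
  (forall s : R, I s -> Derive x s ^ 2 + Derive y s ^ 2 = 1) ->
  nondegenerate I J X ->
  unit_normal I J X N ->
  imcf_self_similar I J X N C ->
  (exists s0 k : R,
     polar_form I gamma
       (fun s => (1 - 2 / C) * (s - s0) ^ 2 + k)
       (fun s => 2 / C * (1 - 2 / C) * (s - s0) ^ 2 + k))
  \/
  (C = 2 /\
   exists m k : R, m <> 0 /\
     polar_form I gamma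
       (fun s => m * s + k)
       (fun s => m * s + k - m ^ 2 / 4)).
Proof.
intros gamma X Hsm Hunit _ HN Hself.
assert (HC : C <> 0) by apply Hself.
pose proof (self_similar_cylinder_base I J x y N C hJ Hunit HN Hself) as Hgk.
pose proof (smooth_plane_curve_derivatives I x y Hsm) as HD.
destruct (radius_quadratic I x y (Derive x) (Derive y)
            (Derive (Derive x)) (Derive (Derive y)) (2 / C)) as [c [d Hfq]]; auto.
all: try (intros s Hs; now apply HD).
{ intros s Hs; rewrite <- (Hgk s Hs); now field. }
assert (Hg0 : forall s, I s -> x s * Derive y s - y s * Derive x s <> 0).
{ intros s Hs E; specialize (Hgk s Hs); rewrite E in Hgk; lra. }
assert (Hg2 : forall s, I s -> (x s * Derive y s - y s * Derive x s) ^ 2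
    = (1 - 2 / C) * s ^ 2 + 2 * c * s + d - ((1 - 2 / C) * s + c) ^ 2).
{ intros s Hs; destruct (Hfq s Hs) as [<- <-].
  transitivity ((x s ^ 2 + y s ^ 2) * (Derive x s ^ 2 + Derive y s ^ 2)
    - (x s * Derive x s + y s * Derive y s) ^ 2); [ring | ].
  rewrite (Hunit s Hs); ring. }
destruct (Req_dec (1 - 2 / C) 0) as [Ha | Ha].
- destruct (Req_dec c 0) as [Hc | Hc].
  + (* A circle centred at the origin: both functions are the constant [d]. *)
    left; exists 0, d; apply plane_curve_polar_form; auto; intros s Hs.
    * rewrite (proj2 (Hfq s Hs)), Ha, Hc; ring.
    * rewrite (Hg2 s Hs), Ha, Hc; ring.
  + right; split.
    * apply (Rmult_eq_reg_r (/ C)); [ | now apply Rinv_neq_0_compat].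
      rewrite Rinv_r by easy; unfold Rdiv in Ha; lra.
    * exists (2 * c), d; split; [lra | ].
      apply plane_curve_polar_form; auto; intros s Hs.
      -- rewrite (proj2 (Hfq s Hs)), Ha; ring.
      -- rewrite (Hg2 s Hs), Ha; field.
- left; exists (- c / (1 - 2 / C)), (d - c ^ 2 / (1 - 2 / C)).
  (* Generalising [2 / C] keeps [C] out of the denominators. *)
  revert Hfq Hg2 Ha; generalize (2 / C); intros b Hfq Hg2 Ha.
  apply plane_curve_polar_form; auto; intros s Hs.
  + rewrite (proj2 (Hfq s Hs)); field; easy.
  + rewrite (Hg2 s Hs); field; easy.
Qed.
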